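(* Let $\mathcal N$ be an admissible algebra, $\pi\in\Pi(\mathcal N)$ and $S:=S_\pi$. For $L\in\mathrm{Aut}(\mathcal N)$ let $c_{L,\pi,\pi}$ be the unique element $c\in S$ satisfying $\pi=L\circ(\pi\circ M_{\exp c})\circ L^{-1}$, and define $\gamma:\mathrm{Aut}(\mathcal N)\to\mathrm{Aff}(\mathcal N)$ by $\gamma(L):=L-L(c_{L,\pi,\pi})$, i.e. $\gamma(L)(x)=L(x)-L(c_{L,\pi,\pi})$. Let $\alpha_\pi:S\to\Pi(\mathcal N)$, $\alpha_\pi(s)=\pi\circ M_{\exp s}$ (which is a bijection). Then $\gamma$ induces a group isomorphism $\mathrm{Aut}(\mathcal N)\to\mathrm{Aff}(S)$. Furthermore, the diagram with horizontal arrows the group actions $\mathrm{Aut}(\mathcal N)\times\Pi(\mathcal N)\to\Pi(\mathcal N)$, $(L,\rho)\mapsto L\circ\rho\circ L^{-1}$, and $\mathrm{Aff}(S)\times S\to S$, $(A,s)\mapsto A(s)$, and with vertical arrows $\gamma:\mathrm{Aut}(\mathcal N)\to\mathrm{Aff}(S)$ and $\alpha_\pi^{-1}:\Pi(\mathcal N)\to S$, commutes and has bijective vertical arrows; that is, $\alpha_\pi^{-1}(L\circ\rho\circ L^{-1})=\gamma(L)\big(\alpha_\pi^{-1}(\rho)\big)$ for all $L\in\mathrm{Aut}(\mathcal N)$ and $\rho\in\Pi(\mathcal N)$.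
   Context: $\mathbb F$ is a field of characteristic $0$; all algebras are associative $\mathbb F$-algebras. An admissible algebra is a commutative nilpotent algebra $\mathcal N$ of finite dimension over $\mathbb F$ whose annihilator $\mathcal N_{[1]}=\{x\in\mathcal N:x\mathcal N=0\}$ has dimension $1$. $\Pi(\mathcal N)$ is the set of all admissible projections, i.e. linear maps $\pi=\pi^2\in\mathrm{End}(\mathcal N)$ with range $\mathcal N_{[1]}$. Put $\exp_1(x)=\sum_{k\ge1}x^k/k!$ for $x\in\mathcal N$ and $S_\pi:=\{x\in\mathcal N:\pi(\exp_1x)=0\}$. $\mathcal N^0=\mathbb F\cdot\mathbf 1\oplus\mathcal N$ is the unital extension, $\exp(x)=\mathbf 1+\exp_1(x)\in\mathcal N^0$, and for $e\in\mathcal N^0$, $M_e\in\mathrm{End}(\mathcal N)$ is $M_e(x)=ex$. $\mathrm{Aut}(\mathcal N)$ is the algebra automorphism group, $\mathrm{Aff}(\mathcal N)$ the group of all affine bijections of $\mathcal N$, and $\mathrm{Aff}(S)=\{g\in\mathrm{Aff}(\mathcal N):g(S)=S\}$. *)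

(* Defs.v *)
From HB Require Import structures.
From mathcomp Require Import all_boot all_order all_algebra ssrAC.
From mathcomp Require Import boolp classical_sets functions.

Set Implicit Arguments.
Unset Strict Implicit.
Unset Printing Implicit Defensive.

Import GRing.Theory.
Local Open Scope ring_scope.
Local Open Scope classical_set_scope.

(* Finite-dimensional commutative associative algebras, not necessarily unital
   (the algebras of the library all have a unit). *)
HB.mixin Record Vector_isNuComAlgebra (F : fieldType) (N : Type)
    of Vector F N := {
  nmul : N -> N -> N;
  nmulA : associative nmul;
  nmulC : commutative nmul;
  nmul_linear : forall y : N, linear (nmul y)
}.

#[short(type="nuComAlgType")]
HB.structure Definition NuComAlgebra (F : fieldType) :=
  {N of Vector F N & Vector_isNuComAlgebra F N}.

Section Algebra.
Variables (F : fieldType) (N : nuComAlgType F).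
Implicit Types (x y z : N) (a b : F).

Lemma nmulDr x : {morph nmul x : y z / y + z}.
Proof. by move=> y z; have := nmul_linear x 1 y z; rewrite !scale1r. Qed.

Lemma nmul0r x : nmul x 0 = 0.
Proof. by apply: (addrI (nmul x 0)); rewrite -nmulDr !addr0. Qed.

Lemma nmulZr a x y : nmul x (a *: y) = a *: nmul x y.
Proof. by have := nmul_linear x a y 0; rewrite nmul0r !addr0. Qed.

Lemma nmulDl z : {morph nmul^~ z : x y / x + y}.
Proof. by move=> x y; rewrite /= !(nmulC _ z) nmulDr. Qed.

Lemma nmul0l x : nmul 0 x = 0. Proof. by rewrite nmulC nmul0r. Qed.

Lemma nmulZl a x y : nmul (a *: x) y = a *: nmul x y.
Proof. by rewrite nmulC nmulZr nmulC. Qed.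

HB.instance Definition _ x :=
  GRing.isLinear.Build F N N *:%R (nmul x) (nmul_linear x).

Definition lmul x : 'End(N) := linfun (nmul x).

Lemma lmul_is_linear : linear lmul.
Proof.
move=> a x y; apply/lfunP => z.
by rewrite !(add_lfunE, scale_lfunE, lfunE) /= nmulDl nmulZl.
Qed.
HB.instance Definition _ :=
  GRing.isLinear.Build F N 'End(N) *:%R lmul lmul_is_linear.

Definition annihilator : {vspace N} := lker (linfun lmul).

Lemma annihilatorP x : reflect (forall y, nmul x y = 0) (x \in annihilator).
Proof.
rewrite memv_ker lfunE; apply: (iffP eqP) => [/lfunP eq0 y|x0].
  by have := eq0 y; rewrite lfunE lfunE.
by apply/lfunP => y; rewrite !lfunE; apply: x0.
Qed.

(* Some power of the algebra vanishes: all products of n.+1 factors are 0. *)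
Definition nilpotent_algebra : Prop :=
  exists n, forall x (s : seq N), size s = n -> foldr nmul x s = 0.

Definition admissible : Prop :=
  nilpotent_algebra /\ \dim annihilator = 1%N.

(* Only meant for k >= 1: N has no unit. *)
Definition npow x (k : nat) : N := iter k.-1 (nmul x) x.

(* exp_1 x = \sum_(k >= 1) x^k / k!; the sum is cut off at the dimension,
   after which all powers vanish (see npow_eq0 and exp1E below). *)
Definition exp1 x : N :=
  \sum_(1 <= k < (\dim {: N}).+1) (k`!%:R)^-1 *: npow x k.

Lemma npow_eq0 x k : nilpotent_algebra -> (\dim {: N} < k)%N -> npow x k = 0.
Proof.
case=> n nilN; case: k => // k; rewrite ltnS /npow /= => lek.
pose T i : 'End(N) := iter i (fun f => lmul x \o f)%VF \1%VF.
have TE i y : T i y = iter i (nmul x) y.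
  by elim: i => [|i IH]; rewrite /= ?comp_lfunE lfunE //= IH.
have limgT i : limg (T i.+1) = (lmul x @: limg (T i))%VS by rewrite /= limg_comp.
have T0 i : T (n + i)%N = 0.
  apply/lfunP => y; rewrite zero_lfunE TE iterD; set z := iter i _ y.
  by rewrite -(nilN z (nseq n x)) ?size_nseq//; elim: n {nilN} => //= m ->.
suff dimT i : limg (T i) = 0%VS \/ (i + \dim (limg (T i)) <= \dim {: N})%N.
  have : T k x \in limg (T k) by rewrite memv_img ?memvf.
  rewrite TE; case: (dimT k) => [->|ledim]; first by rewrite memv0 => /eqP.
  have /eqP : \dim (limg (T k)) == 0%N.
    by rewrite -leqn0 -(leq_add2l k) addn0 (leq_trans ledim).
  by move/eqP; rewrite dimv_eq0 => /eqP ->; rewrite memv0 => /eqP.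
elim: i => [|i IH]; first by right; rewrite add0n dimvS ?subvf.
have subT : (limg (T i.+1) <= limg (T i))%VS.
  elim: i {IH} => [|i IH]; first by rewrite /= limg_comp lim1g subvf.
  by rewrite (limgT i.+1) [X in (_ <= X)%VS]limgT limgS.
case: IH => [T_i0|ledim]; first by left; rewrite limgT T_i0 limg0.
have := dimvS subT; rewrite leq_eqVlt => /orP[eqdim|ltdim]; last first.
  by right; rewrite addSnnS (leq_trans _ ledim) ?leq_add2l.
have eqT : limg (T i.+1) = limg (T i) by apply/eqP; rewrite eqEdim subT (eqP eqdim) /=.
have eqTm m : limg (T (m + i)%N) = limg (T i).
  by elim: m => // m IH; rewrite addSn limgT IH -limgT eqT.
by left; rewrite eqT -(eqTm n) T0 lim0g.
Qed.

Lemma exp1E x m : nilpotent_algebra -> (\dim {: N} <= m)%N ->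
  exp1 x = \sum_(1 <= k < m.+1) (k`!%:R)^-1 *: npow x k.
Proof.
move=> nilN lem; rewrite /exp1 [RHS](big_cat_nat (n := (\dim {: N}).+1)) //=.
rewrite -[LHS]addr0; congr (_ + _); rewrite big_nat big1 // => k /andP[ltk _].
by rewrite npow_eq0 ?scaler0.
Qed.

(* N^0 = F.1 (+) N, with (a, x) standing for a.1 + x. *)
Definition unital_ext : Type := (F^o * N)%type.
HB.instance Definition _ := GRing.Lmodule.on unital_ext.

Implicit Types e : unital_ext.

Definition uext_one : unital_ext := (1, 0).
Definition uext_mul e1 e2 : unital_ext :=
  (e1.1 * e2.1, (e1.1 : F) *: e2.2 + (e2.1 : F) *: e1.2 + nmul e1.2 e2.2).

Lemma uext_mulA : associative uext_mul.
Proof.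
move=> [a x] [b y] [c z]; congr (_, _); rewrite /= ?mulrA //.
rewrite !(nmulDr, nmulDl, nmulZl, nmulZr, scalerDr, scalerA) nmulA.
rewrite (mulrC c a) (mulrC c b) !addrA.
by rewrite [RHS](ACl (1*2*5*3*6*4*7))%AC.
Qed.

Lemma uext_mulC : commutative uext_mul.
Proof.
move=> [a x] [b y]; congr (_, _); rewrite /= ?[a * b]mulrC //.
by rewrite nmulC [a *: _ + _]addrC.
Qed.

Lemma uext_mul1 : left_id uext_one uext_mul.
Proof.
by move=> [a x]; rewrite /uext_mul /= mul1r scale1r scaler0 nmul0l !addr0.
Qed.

Lemma uext_mulDl : left_distributive uext_mul +%R.
Proof.
move=> [a x] [b y] [c z]; congr (_, _); rewrite /= ?mulrDl //.
by rewrite nmulDl scalerDr scalerDl !addrA [RHS](ACl (1*4*2*5*3*6))%AC.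
Qed.

Lemma uext_one_neq0 : uext_one != 0.
Proof. by apply/eqP => -[/eqP]; rewrite oner_eq0. Qed.

HB.instance Definition _ := GRing.Zmodule_isComNzRing.Build unital_ext
  uext_mulA uext_mulC uext_mul1 uext_mulDl uext_one_neq0.

Lemma uext_scaleAl a e1 e2 : a *: (e1 * e2) = (a *: e1) * e2.
Proof.
case: e1 e2 => [b x] [c y]; congr (_, _); rewrite /= ?scalerAl //.
by rewrite nmulZl !scalerDr !scalerA (mulrC c).
Qed.

HB.instance Definition _ :=
  GRing.Lmodule_isLalgebra.Build F unital_ext uext_scaleAl.
HB.instance Definition _ := GRing.Lalgebra_isComAlgebra.Build F unital_ext.

Definition uext_inj x : unital_ext := (0, x).

Definition exp x : unital_ext := 1 + uext_inj (exp1 x).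

Definition uext_act e x : N := (e * uext_inj x).2.

(* The product of N^0 maps N into itself. *)
Lemma uext_injM e x : uext_inj (uext_act e x) = e * uext_inj x.
Proof. by congr (_, _); rewrite /= mulr0. Qed.

Lemma uext_actE e x : uext_act e x = (e.1 : F) *: x + nmul e.2 x.
Proof. by rewrite /uext_act /= scale0r addr0. Qed.

Lemma uext_act_is_linear e : linear (uext_act e).
Proof.
move=> a x y; rewrite !uext_actE nmulDr nmulZr !scalerDr !scalerA mulrC.
by rewrite addrACA.
Qed.
HB.instance Definition _ e :=
  GRing.isLinear.Build F N N *:%R (uext_act e) (uext_act_is_linear e).

Definition Mul e : 'End(N) := linfun (uext_act e).

Definition admproj : set 'End(N) :=
  [set p | (p \o p)%VF = p /\ limg p = annihilator].

Definition Spi (p : 'End(N)) : set N := [set x | p (exp1 x) = 0].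

Definition alpha (p : 'End(N)) (s : N) : 'End(N) := (p \o Mul (exp s))%VF.

Lemma alpha_admproj p s : admproj p -> admproj (alpha p s).
Proof.
case=> pp pann.
have annM z : z \in annihilator -> Mul (exp s) z = z.
  move/annihilatorP => annz; rewrite lfunE /= uext_actE /= addr0 scale1r.
  by rewrite nmulC annz addr0.
have pz x : p x \in annihilator by rewrite -pann memv_img ?memvf.
have pid z : z \in annihilator -> p z = z.
  by rewrite -pann => /memv_imgP[y _ ->]; rewrite -comp_lfunE pp.
split.
  by apply/lfunP => x; rewrite !comp_lfunE annM // pid.
apply/eqP; rewrite eqEsubv; apply/andP; split.
  by apply/subvP => _ /memv_imgP[y _ ->]; rewrite comp_lfunE.
apply/subvP => z zann; apply/memv_imgP; exists z; first exact: memvf.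
by rewrite comp_lfunE annM // pid.
Qed.

(* The inverse of alpha p : Spi p -> admproj; junk value 0 outside the image. *)
Definition alpha_inv (p : 'End(N)) : 'End(N) -> N :=
  'pinv_(fun=> 0) (Spi p) (alpha p).

End Algebra.

Section Automorphisms.
Variables (F : fieldType) (N : nuComAlgType F).

Definition is_autalg (L : 'End(N)) : Prop :=
  bijective L /\ {morph L : x y / nmul x y}.

Record autalg : Type := AutAlg {
  autalg_val :> 'End(N);
  autalg_subproof : `[< is_autalg autalg_val >]
}.
HB.instance Definition _ := [isSub for autalg_val].
HB.instance Definition _ := [Choice of autalg by <:].

Implicit Types L : autalg.

Lemma autalgP L : is_autalg L. Proof. exact/asboolP/(valP L). Qed.

Lemma autalg_lker0 L : lker L == 0%VS.
Proof. by apply/lker0P/bij_inj; case: (autalgP L). Qed.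

Fact autalg1_subproof : `[< is_autalg \1%VF >].
Proof.
apply/asboolP; split; last by move=> x y; rewrite !id_lfunE.
by exists id => x; rewrite id_lfunE.
Qed.

Fact autalgM_subproof L1 L2 : `[< is_autalg (L1 \o L2)%VF >].
Proof.
apply/asboolP; have [[b1 m1] [b2 m2]] := (autalgP L1, autalgP L2); split.
  by apply: (eq_bij (bij_comp b1 b2)) => x; rewrite comp_lfunE.
by move=> x y; rewrite !comp_lfunE m2 m1.
Qed.

Fact autalgV_subproof L : `[< is_autalg (L^-1)%VF >].
Proof.
apply/asboolP; have L0 := autalg_lker0 L; have [_ mL] := autalgP L; split.
  by exists L; [exact: lker0_lfunVK | exact: lker0_lfunK].
move=> x y; apply: (can_inj (lker0_lfunK L0)).
by rewrite mL !lker0_lfunVK.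
Qed.

Definition autalg_one := AutAlg autalg1_subproof.
Definition autalg_mul L1 L2 := AutAlg (autalgM_subproof L1 L2).
Definition autalg_inv L := AutAlg (autalgV_subproof L).

Lemma autalg_mulA : associative autalg_mul.
Proof. by move=> L1 L2 L3; apply: val_inj; rewrite /= comp_lfunA. Qed.
Lemma autalg_mul1 : left_id autalg_one autalg_mul.
Proof. by move=> L; apply: val_inj; rewrite /= comp_lfun1l. Qed.
Lemma autalg_mulr1 : right_id autalg_one autalg_mul.
Proof. by move=> L; apply: val_inj; rewrite /= comp_lfun1r. Qed.
Lemma autalg_mulV : left_inverse autalg_one autalg_inv autalg_mul.
Proof.
by move=> L; apply: val_inj; rewrite /= lker0_compVf // autalg_lker0.
Qed.
Lemma autalg_mulrV : right_inverse autalg_one autalg_inv autalg_mul.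
Proof.
by move=> L; apply: val_inj; rewrite /= lker0_compfV // autalg_lker0.
Qed.

HB.instance Definition _ := isGroup.Build autalg autalg_mulA autalg_mul1
  autalg_mulr1 autalg_mulV autalg_mulrV.

Definition conj_act L (p : 'End(N)) : 'End(N) := (L \o p \o L^-1)%VF.

Lemma autalg_annihilator L : (L @: annihilator N)%VS = annihilator N.
Proof.
have sub (K : autalg) : (K @: annihilator N <= annihilator N)%VS.
  apply/subvP => _ /memv_imgP[x /annihilatorP annx ->].
  apply/annihilatorP => y; have [_ mK] := autalgP K.
  by rewrite -[y](lker0_lfunVK (autalg_lker0 K)) -mK annx linear0.
apply/eqP; rewrite eqEsubv sub /=.
have /(limgS L) := sub (autalg_inv L).
by rewrite -limg_comp /= lker0_compfV ?autalg_lker0 // lim1g.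
Qed.

Lemma conj_act_admproj L p : admproj p -> admproj (conj_act L p).
Proof.
case=> pp pann; have L0 := autalg_lker0 L; split.
  apply/lfunP => x; rewrite /conj_act !comp_lfunE lker0_lfunK //.
  by rewrite -[in RHS]pp !comp_lfunE.
rewrite /conj_act !limg_comp.
have -> : (L^-1 @: fullv)%VS = fullv.
  apply/eqP; rewrite eqEsubv subvf; apply/subvP => x _; apply/memv_imgP.
  by exists (L x); rewrite ?memvf ?lker0_lfunK.
by rewrite pann autalg_annihilator.
Qed.

End Automorphisms.

Section AffineBijections.
Variables (F : fieldType) (V : vectType F).

Definition is_affine (g : V -> V) : Prop :=
  exists (A : 'End(V)) (b : V), forall x, g x = A x + b.

Record affbij : Type := AffBij {
  affbij_val :> V -> V;
  affbij_subproof : `[< is_affine affbij_val /\ bijective affbij_val >]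
}.
HB.instance Definition _ := [isSub for affbij_val].
HB.instance Definition _ := [Choice of affbij by <:].

Implicit Types g : affbij.

Lemma affbijP g : is_affine g /\ bijective g.
Proof. exact/asboolP/(valP g). Qed.

Fact affbij1_subproof :
  `[< is_affine (@idfun V) /\ bijective (@idfun V) >].
Proof.
apply/asboolP; split; last by exists id.
by exists \1%VF, 0 => x; rewrite id_lfunE addr0.
Qed.

Fact affbijM_subproof g1 g2 :
  `[< is_affine (g1 \o g2) /\ bijective (g1 \o g2) >].
Proof.
apply/asboolP; have [[A1 [b1 E1]] bij1] := affbijP g1.
have [[A2 [b2 E2]] bij2] := affbijP g2; split; last exact: bij_comp.
exists (A1 \o A2)%VF, (A1 b2 + b1) => x.
by rewrite /= E1 E2 linearD comp_lfunE addrA.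
Qed.

Fact affbij_inv_subproof g :
  {h : V -> V | `[< is_affine h /\ bijective h >] & cancel g h /\ cancel h g}.
Proof.
apply: cid2; have [[A [b E]] [h gK hK]] := affbijP g.
exists h => //; apply/asboolP; split; last by exists g.
have A0 : lker A == 0%VS.
  apply/lker0P => x y Axy; apply: (can_inj gK).
  by rewrite !E Axy.
exists (A^-1)%VF, (- (A^-1)%VF b) => x.
have {2}-> : x = A (h x) + b by rewrite -E hK.
by rewrite linearD addrK; exact/esym/(lker0_lfunK A0).
Qed.

Definition affbij_one := AffBij affbij1_subproof.
Definition affbij_mul g1 g2 := AffBij (affbijM_subproof g1 g2).
Definition affbij_inv g := AffBij (s2valP (affbij_inv_subproof g)).

Lemma affbij_mulA : associative affbij_mul.
Proof. by move=> g1 g2 g3; apply: val_inj. Qed.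
Lemma affbij_mul1 : left_id affbij_one affbij_mul.
Proof. by move=> g; apply: val_inj. Qed.
Lemma affbij_mulr1 : right_id affbij_one affbij_mul.
Proof. by move=> g; apply: val_inj. Qed.
Lemma affbij_mulV : left_inverse affbij_one affbij_inv affbij_mul.
Proof.
move=> g; apply: val_inj; apply/funext => x /=.
by case: (s2valP' (affbij_inv_subproof g)) => gK _; exact: gK.
Qed.
Lemma affbij_mulrV : right_inverse affbij_one affbij_inv affbij_mul.
Proof.
move=> g; apply: val_inj; apply/funext => x /=.
by case: (s2valP' (affbij_inv_subproof g)) => _ gK; exact: gK.
Qed.

HB.instance Definition _ := isGroup.Build affbij affbij_mulA affbij_mul1
  affbij_mulr1 affbij_mulV affbij_mulrV.

Definition affstab (S : set V) : set affbij := [set g : affbij | g @` S = S].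

Lemma affstab_group (S : set V) :
  [/\ affstab S 1%g,
      forall g1 g2, affstab S g1 -> affstab S g2 -> affstab S (g1 * g2)%g &
      forall g, affstab S g -> affstab S (g^-1)%g].
Proof.
split=> [|g1 g2 S1 S2|g Sg]; rewrite /affstab /=; first exact: image_id.
  by rewrite -[LHS]/((g1 \o g2) @` S) -image_comp S2 S1.
rewrite -[in LHS]Sg image_comp -[RHS]image_id; apply: eq_imagel => x _ /=.
by have /(congr1 (fun h : affbij => h x)) := mulVg g.
Qed.

End AffineBijections.

Section Gamma.
Variables (F : fieldType) (N : nuComAlgType F).
Variable p : 'End(N).
Implicit Types L : autalg N.

Definition is_ctrans L : set N :=
  [set c | Spi p c /\ p = conj_act L (alpha p c)].

(* The element c_{L,p,p}; junk value 0 should there be none. *)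
Definition ctrans L : N := xget 0 (is_ctrans L).

Fact gamma_subproof L :
  `[< is_affine (fun x => L x - L (ctrans L)) /\
      bijective (fun x => L x - L (ctrans L)) >].
Proof.
apply/asboolP; split; first by exists L, (- L (ctrans L)).
have L0 := autalg_lker0 L; set b := L _.
exists (fun x => (L^-1)%VF (x + b)) => x; first by rewrite subrK lker0_lfunK.
by rewrite lker0_lfunVK // addrK.
Qed.

Definition gamma L : affbij N := AffBij (gamma_subproof L).

End Gamma.

(* Main.v *)
Require Import Defs.
From HB Require Import structures.
From mathcomp Require Import all_boot all_order all_algebra ring.
From mathcomp Require Import boolp classical_sets functions.

Set Implicit Arguments.
Unset Strict Implicit.
Unset Printing Implicit Defensive.

Import GRing.Theory.
Local Open Scope ring_scope.
Local Open Scope classical_set_scope.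

(* The exponential law gives both that alpha p is a bijection (nilpotency makes
   exp_1 bijective, and the pairing p (x z) is perfect modulo the annihilator)
   and that gamma p L corresponds to conjugation by L under alpha p, whence
   gamma p is a homomorphism into Aff(S).

   Surjectivity: if g in Aff(S) has linear part A and g c = 0 with c in S, then
   A maps S_q onto S_p, where q = alpha p c. Let u and w be the coordinates of q
   and p along a generator of the annihilator. The polynomials u (exp_1 x) and
   w (exp_1 (A x)) have the same zeros, and both hypersurfaces are graphs; this
   forces each to divide the other on every line, so they are proportional.
   Comparing the homogeneous parts of degree 1, 2, 3 and polarizing shows that
   A (x y) - A x A y is orthogonal to N and killed by p, hence 0. So A is an
   automorphism carrying q to p, and gamma p A = g. *)

Lemma dimv1_line (F : fieldType) (V : vectType F) (U : {vspace V}) :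
  \dim U = 1%N -> exists2 a, a != 0 & U = <[a]>%VS.
Proof.
move=> dimU; exists (vpick U); first by rewrite vpick0 -dimv_eq0 dimU.
apply/esym/eqP; rewrite eqEdim -memvE memv_pick dimU dim_vline.
by rewrite vpick0 -dimv_eq0 dimU.
Qed.

(** * The exponential law and the bijectivity of [exp1] *)

Section Exponential.
Variables (F : fieldType) (N : nuComAlgType F).
Variables (charF0 : [pchar F] =i pred0) (nilN : nilpotent_algebra N).
Implicit Types (x y z : N) (t : F) (k : nat).

(** Induction on a length [n] such that all products of [y] with [n] further factors vanish; passing
    to [nmul y u] lowers it by one. *)
Lemma nilpotent_ind (P : N -> Prop) :
  P 0 -> (forall y, (forall u, P (nmul y u)) -> P y) -> forall y, P y.
Proof.
move=> P0 Pstep y; case: nilN => n nil; move: (nil y); move: n y {nil}.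
elim=> [|n IH] y y0; first by rewrite -[y]/(foldr nmul y [::]) y0.
apply: Pstep => u; apply: IH => s sz_s.
by rewrite nmulC -[LHS](foldr_rcons nmul y) y0 // size_rcons sz_s.
Qed.

Lemma nmulNr x y : nmul x (- y) = - nmul x y.
Proof. exact: linearN. Qed.

Lemma nmulNl x y : nmul (- x) y = - nmul x y.
Proof. by rewrite nmulC nmulNr nmulC. Qed.

Lemma fact_neq0 k : (k`!%:R : F) != 0.
Proof. by rewrite (proj1 (pcharf0P F)) // -lt0n fact_gt0. Qed.

Lemma uext_inj_is_linear : linear (@uext_inj F N).
Proof. by move=> t x y; congr (_, _); rewrite /= addr0 [RHS]mulr0. Qed.
HB.instance Definition _ := GRing.isLinear.Build F N (unital_ext N) *:%R
  (@uext_inj F N) uext_inj_is_linear.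

Lemma uext_injMn x y : uext_inj x * uext_inj y = uext_inj (nmul x y).
Proof. by congr (_, _); rewrite /= ?mulr0 // !scale0r !add0r. Qed.

Lemma uext_injX x k : uext_inj x ^+ k.+1 = uext_inj (npow x k.+1).
Proof. by elim: k => // k IH; rewrite exprS IH uext_injMn. Qed.

Lemma MulE x y : Mul (exp x) y = y + nmul (exp1 x) y.
Proof. by rewrite lfunE /= uext_actE /= addr0 scale1r add0r. Qed.

Lemma uext_inj_Mul x y : uext_inj (Mul (exp x) y) = exp x * uext_inj y.
Proof. by rewrite lfunE /= uext_injM. Qed.

Lemma uext_inj_inj : injective (@uext_inj F N).
Proof. by move=> x y []. Qed.

(* Over N^0 the truncated series has all the coefficients of exp (x X), so the
   exponential law is a coefficientwise Cauchy product. *)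
Definition exp_poly x : {poly unital_ext N} :=
  \poly_(k < (\dim {: N}).+1) ((k`!%:R)^-1 *: uext_inj x ^+ k).

Lemma coef_exp_poly x k : (exp_poly x)`_k = (k`!%:R)^-1 *: uext_inj x ^+ k.
Proof.
rewrite coef_poly; case: ltnP => //; case: k => // k ltk.
by rewrite uext_injX npow_eq0 // linear0.
Qed.

Lemma exp_poly1 x : (exp_poly x).[1] = exp x.
Proof.
rewrite horner_poly big_ord_recl invr1 scale1r expr1n mulr1 expr0.
congr (_ + _).
rewrite /exp1 big_add1 big_mkord linear_sum; apply: eq_bigr => i _.
by rewrite expr1n mulr1 uext_injX linearZ.
Qed.

Lemma exp_polyD x y : exp_poly (x + y) = exp_poly x * exp_poly y.
Proof.
apply/polyP => k; rewrite coefM coef_exp_poly addrC linearD exprDn scaler_sumr.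
apply: eq_bigr => i _; have lei : (i <= k)%N by rewrite -ltnS.
rewrite !coef_exp_poly -scalerAl -scalerAr scalerA -scaler_nat scalerA mulrC.
congr (_ *: _); last by rewrite mulrC.
apply: (mulIf (fact_neq0 k)); rewrite mulfVK ?fact_neq0 //.
rewrite -(bin_fact lei) !natrM [X in _ * X]mulrCA mulrA.
by field; rewrite !fact_neq0.
Qed.

Lemma expD x y : exp (x + y) = exp x * exp y.
Proof. by rewrite -!exp_poly1 exp_polyD hornerM. Qed.

Lemma MulD x y z : Mul (exp (x + y)) z = Mul (exp x) (Mul (exp y) z).
Proof. by apply: uext_inj_inj; rewrite !uext_inj_Mul expD mulrA. Qed.

Lemma exp1D x y : exp1 (x + y) = exp1 x + Mul (exp x) (exp1 y).
Proof.
apply: uext_inj_inj; apply: (@addrI _ (1 : unital_ext N)).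
rewrite linearD /= uext_inj_Mul addrA -[LHS]/(exp (x + y)) -/(exp x) expD.
by rewrite [exp y]/(1 + _) mulrDr mulr1.
Qed.

Lemma exp1_factor x : exists w, exp1 x = x + nmul x w.
Proof.
exists (\sum_(i < \dim {: N}) ((i.+2)`!%:R)^-1 *: npow x i.+1).
(* The cutoff is raised by one so that a first term [x] can be split off even in dimension 0. *)
rewrite (exp1E x nilN (leqnSn _)) big_add1 big_mkord big_ord_recl invr1 scale1r.
congr (_ + _); rewrite linear_sum; apply: eq_bigr => i _.
by rewrite linearZ.
Qed.

Lemma exp1_0 : exp1 0 = 0 :> N.
Proof. by have [w ->] := exp1_factor 0; rewrite nmul0l addr0. Qed.

Lemma Mul0 z : Mul (exp 0) z = z.
Proof. by rewrite MulE exp1_0 nmul0l addr0. Qed.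

Lemma MulK x : cancel (Mul (exp x)) (Mul (exp (- x))).
Proof. by move=> z; rewrite -MulD addNr Mul0. Qed.

Lemma exp1_ann x : x \in annihilator N -> exp1 x = x.
Proof.
by move=> /annihilatorP x0; have [w ->] := exp1_factor x; rewrite x0 addr0.
Qed.

(** By [exp1_factor], [x = nmul x (- w)], so [x] is a multiple of itself and nilpotency kills it. *)
Lemma exp1_eq0 x : exp1 x = 0 -> x = 0.
Proof.
have [w ->] := exp1_factor x => /eqP; rewrite addr_eq0 -linearN => /eqP.
move: (- w) => {}w; move: x; apply: nilpotent_ind => // y IH Ey.
by rewrite Ey; apply: IH; rewrite -Ey.
Qed.

Lemma exp1_inj : injective (@exp1 F N).
Proof.
move=> x y Exy; apply/subr0_eq/exp1_eq0; apply: (can_inj (MulK y)).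
rewrite linear0; apply: (addrI (exp1 y)).
by rewrite -exp1D addr0 addrC subrK.
Qed.

(** The approximation [y] is corrected by some [z] with [exp1 z = exp1 (- y) + Mul (exp (- y)) y].
    The linear terms on the right cancel, leaving a multiple of [y], to which the induction
    applies. *)
Lemma exp1_surj y : exists x, exp1 x = y.
Proof.
move: y; apply: nilpotent_ind => [|y IH]; first by exists 0; exact: exp1_0.
have [w Ew] := exp1_factor (- y).
have [z Ez] := IH (- (w + y) - nmul y w).
have {}Ez : exp1 z = exp1 (- y) + Mul (exp (- y)) y.
  rewrite Ez MulE Ew opprD !(nmulDl, nmulDr, nmulNl, nmulNr).
  rewrite [nmul (nmul y w) y]nmulC.
  by rewrite addrACA addNr add0r addrA.
exists (y + z).
by rewrite exp1D Ez linearD /= -MulD subrr Mul0 addrA -exp1D subrr exp1_0 add0r.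
Qed.

(** * Admissible projections and the bijection [alpha p] *)

Section AdmissibleProjection.
Variables (p : 'End(N)) (Pi_p : admproj p).

Lemma admproj_id z : z \in annihilator N -> p z = z.
Proof.
by case: Pi_p => pp <- /memv_imgP[y _ ->]; rewrite -comp_lfunE pp.
Qed.

Lemma admproj_ann x : p x \in annihilator N.
Proof. by case: Pi_p => _ <-; rewrite memv_img ?memvf. Qed.

(** Each [nmul y u] inherits both hypotheses, so by induction it is 0; then [y] lies in the
    annihilator, where [p] is the identity. *)
Lemma admproj_nondeg y : p y = 0 -> (forall z, p (nmul y z) = 0) -> y = 0.
Proof.
move: y; apply: nilpotent_ind => // y IH py pyz.
suff /admproj_id : y \in annihilator N by rewrite py.
apply/annihilatorP => u; apply: IH => // z.
by rewrite -nmulA pyz.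
Qed.

Lemma alpha_inj : {in Spi p &, injective (alpha p)}.
Proof.
move=> s t; rewrite !inE /Spi /= => ps pt /lfunP Est; apply: exp1_inj.
apply/subr0_eq/admproj_nondeg; first by rewrite linearB /= ps pt subrr.
move=> z; have := Est z; rewrite !comp_lfunE !MulE !linearD /= => /addrI Ez.
by rewrite nmulDl nmulNl linearB /= Ez subrr.
Qed.

Lemma admproj_form a : a != 0 -> annihilator N = <[a]>%VS ->
  exists2 w : 'Hom(N, F^o), w a = 1 & forall x, p x = w x *: a.
Proof.
move=> a0 annE; pose w := (linfun (coord [tuple a] ord0 : N -> F^o) \o p)%VF.
have Ew x : p x = w x *: a.
  have : p x \in <<[tuple a]>>%VS by rewrite span_seq1 -annE admproj_ann.
  by move/coord_span => {1}->; rewrite big_ord1 comp_lfunE lfunE.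
exists w => //; apply/eqP; rewrite -subr_eq0.
have /eqP : (w a - 1) *: a = 0.
  by rewrite scalerBl scale1r -Ew admproj_id ?annE ?memv_line // subrr.
by rewrite scaler_eq0 (negPf a0) orbF.
Qed.

End AdmissibleProjection.

(* x |-> p (x _) maps N / Ann N injectively, hence by dimension bijectively, to
   the linear maps N -> Ann N that vanish on Ann N. *)
Lemma admproj_diff p q : \dim (annihilator N) = 1%N -> admproj p -> admproj q ->
  exists x, forall z, q z = p (z + nmul x z).
Proof.
move=> dimA Pi_p Pi_q; have [a a0 annE] := dimv1_line dimA.
have [w wa Ew] := admproj_form Pi_p a0 annE.
have [w' wa' Ew'] := admproj_form Pi_q a0 annE.
pose Psi_fun x : 'Hom(N, F^o) := (w \o lmul x)%VF.
have Psi_lin : linear Psi_fun.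
  by move=> t x y; rewrite /Psi_fun linearP comp_lfunDr comp_lfunZr.
pose Psi := linfun (HB.pack_for {linear N -> 'Hom(N, F^o)} Psi_fun
  (GRing.isLinear.Build _ _ _ _ Psi_fun Psi_lin)).
pose ev_fun (f : 'Hom(N, F^o)) : F^o := f a.
have ev_lin : linear ev_fun.
  by move=> t f g; rewrite /ev_fun add_lfunE scale_lfunE.
pose ev := linfun (HB.pack_for {linear 'Hom(N, F^o) -> F^o} ev_fun
  (GRing.isLinear.Build _ _ _ _ ev_fun ev_lin)).
have PsiE x z : Psi x z = w (nmul x z) by rewrite lfunE /= comp_lfunE lfunE.
have evE f : ev f = f a by rewrite lfunE.
have kerPsi : lker Psi = annihilator N.
  apply/vspaceP => x; apply/idP/annihilatorP => [|x0]; last first.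
    by rewrite memv_ker; apply/eqP/lfunP => z; rewrite PsiE x0 linear0 lfunE.
  rewrite memv_ker => /eqP /lfunP Px.
  have pxz z : p (nmul x z) = 0 by rewrite Ew -PsiE Px lfunE scale0r.
  by move=> y; apply: (admproj_nondeg Pi_p) => // z; rewrite -nmulA pxz.
have subK : (limg Psi <= lker ev)%VS.
  apply/subvP => _ /memv_imgP[x _ ->]; rewrite memv_ker evE PsiE nmulC.
  have /annihilatorP -> : a \in annihilator N by rewrite annE memv_line.
  by rewrite linear0.
have dimPsi := limg_ker_dim Psi fullv.
have dimev := limg_ker_dim ev fullv.
rewrite !capfv kerPsi dimA !dimvf in dimPsi dimev.
have ev_gt0 : (0 < \dim (limg ev))%N.
  rewrite lt0n dimv_eq0; apply: contraTneq (memv_img ev (memvf w)) => ->.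
  by rewrite memv0 evE wa oner_eq0.
(* The image has dimension [dim N - 1], and [lker ev] has at most that dimension because
   [ev w = 1]. *)
have eqK : limg Psi = lker ev.
  apply/eqP; rewrite eqEdim subK -(leq_add2l 1) dimPsi add1n.
  have -> : dim N = dim 'Hom(N, F^o) by rewrite /dim /= muln1.
  by rewrite -dimev -addn1 leq_add2l.
have : (w' - w)%R \in limg Psi.
  by rewrite eqK memv_ker evE add_lfunE opp_lfunE wa wa' subrr.
move=> /memv_imgP[x _ /lfunP Ex]; exists x => z.
rewrite Ew' Ew linearD /= -PsiE -Ex add_lfunE opp_lfunE addrC subrK //.
Qed.

Section AlphaBijection.
Variables (p : 'End(N)) (Pi_p : admproj p).

(** By [admproj_diff], [q] is [p] after multiplication by [1 + x], and [x = exp1 y] for some [y].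
    Subtracting the annihilator element [p x] preserves all products and moves [y] into [Spi p]. *)
Lemma alpha_surj q : \dim (annihilator N) = 1%N -> admproj q ->
  exists2 s, Spi p s & alpha p s = q.
Proof.
move=> dimA Pi_q; have [x Ex] := admproj_diff dimA Pi_p Pi_q.
have [y Ey] := exp1_surj x; have annpx := admproj_ann Pi_p x.
have Es : exp1 (y - p x) = x - p x.
  rewrite addrC exp1D exp1_ann ?rpredN // Ey MulE exp1_ann ?rpredN //.
  by rewrite nmulNl (annihilatorP _ annpx) subr0 addrC.
exists (y - p x).
  by rewrite /Spi /= Es linearB /= [X in _ - X](admproj_id Pi_p) // subrr.
apply/lfunP => z; rewrite Ex comp_lfunE MulE Es nmulDl nmulNl.
by rewrite (annihilatorP _ annpx) subr0.
Qed.

(** Moving the origin to a point of the hypersurface yields a hypersurface of the same kind; this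
    reduces affine symmetries to linear maps. *)
Lemma Spi_translate c y : Spi p c -> Spi p (c + y) <-> Spi (alpha p c) y.
Proof.
by rewrite /Spi /= => pc; rewrite exp1D linearD /= pc add0r comp_lfunE.
Qed.

End AlphaBijection.

End Exponential.

Lemma affbij_ext (F : fieldType) (V : vectType F) (g h : affbij V) :
  g =1 h -> g = h.
Proof. by move=> Egh; apply/val_inj/funext. Qed.

(** * Conjugation by automorphisms and the homomorphism [gamma p] *)

Section GammaAction.
Variables (F : fieldType) (N : nuComAlgType F).
Variables (charF0 : [pchar F] =i pred0) (admN : admissible N).
Variables (p : 'End(N)) (Pi_p : admproj p).
Implicit Types (L : autalg N) (x y : N).

Lemma autalgM L x y : L (nmul x y) = nmul (L x) (L y).
Proof. by case: (autalgP L) => _ ->. Qed.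

Lemma autalg_exp1 L x : L (exp1 x) = exp1 (L x).
Proof.
rewrite linear_sum; apply: eq_bigr => k _; rewrite linearZ /=; congr (_ *: _).
by rewrite /npow; elim: k.-1 => //= i IH; rewrite autalgM IH.
Qed.

Lemma autalg_Mul L x y : L (Mul (exp x) y) = Mul (exp (L x)) (L y).
Proof. by rewrite !MulE linearD /= autalgM autalg_exp1. Qed.

Lemma conj_actP L p1 q :
  q = conj_act L p1 <-> forall x, q (L x) = L (p1 x).
Proof.
have L0 := autalg_lker0 L; split=> [-> x|qL].
  by rewrite !comp_lfunE lker0_lfunK.
by apply/lfunP => x; rewrite !comp_lfunE -qL lker0_lfunVK.
Qed.

Lemma conj_actM L1 L2 p1 :
  conj_act (L1 * L2)%g p1 = conj_act L1 (conj_act L2 p1).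
Proof.
have mulE x : (L1 * L2)%g x = L1 (L2 x) by exact: comp_lfunE.
apply/esym/conj_actP => x; rewrite !mulE.
by do 2!rewrite (proj1 (conj_actP _ _ _) erefl).
Qed.

Lemma conj_act1 p1 : conj_act (1%g : autalg N) p1 = p1.
Proof. by apply/esym/conj_actP => x; rewrite !id_lfunE. Qed.

(** The equation says that [alpha p c] is the conjugate of [p] by [L^-1], so bijectivity of
    [alpha p] applies. *)
Lemma ctrans_exists_unique L : exists! c : N, is_ctrans p L c.
Proof.
have [nilN dimA] := admN.
have [c Sc Ec] :=
  alpha_surj charF0 nilN Pi_p dimA (conj_act_admproj L^-1%g Pi_p).
have ctransE d : p = conj_act L (alpha p d) <-> alpha p d = alpha p c.
  rewrite Ec; split=> [Ep|->]; last by rewrite -conj_actM mulgV conj_act1.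
  by rewrite [in RHS]Ep -conj_actM mulVg conj_act1.
exists c; split=> [|d [Sd /ctransE Ed]]; first by split=> //; apply/ctransE.
by apply/esym; apply: (alpha_inj charF0 nilN Pi_p) => //; apply/mem_set.
Qed.

Lemma ctransP L : is_ctrans p L (ctrans p L).
Proof.
by apply: xgetPex; have [c [Lc _]] := ctrans_exists_unique L; exists c.
Qed.

(** Since [L] intertwines [alpha p c] with [p], pulling [L] out to the left contributes a factor
    [exp c], which cancels the shift in [gamma]. *)
Lemma alpha_gamma L s : alpha p (gamma p L s) = conj_act L (alpha p s).
Proof.
have [nilN _] := admN; have [_ /conj_actP pL] := ctransP L.
apply/conj_actP => x; rewrite !comp_lfunE /= -linearB -autalg_Mul pL.
by rewrite comp_lfunE -MulD // addrC subrK.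
Qed.

Lemma gamma_Spi L s : Spi p (gamma p L s) <-> Spi p s.
Proof.
have [nilN _] := admN; have [Sc /conj_actP pL] := ctransP L.
rewrite /Spi /= -linearB -autalg_exp1 pL comp_lfunE.
have -> : p (exp1 s) = p (Mul (exp (ctrans p L)) (exp1 (s - ctrans p L))).
  rewrite -{1}[s](subrK (ctrans p L)) [in LHS]addrC exp1D // linearD /=.
  by rewrite [X in X + _]Sc add0r.
split=> [Lz|->]; last by rewrite linear0.
by apply: (lker0P (autalg_lker0 L)); rewrite Lz linear0.
Qed.

(** Both sides are affine with the same linear part, so it suffices to compare them at 0. There both
    values lie in [Spi p] and have the same image under [alpha p]. *)
Lemma gammaM : {morph gamma p : L1 L2 / (L1 * L2)%g}.
Proof.
have [nilN _] := admN.
move=> L1 L2; have S0 : Spi p 0 by rewrite /Spi /= exp1_0 // linear0.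
have E0 : gamma p (L1 * L2)%g 0 = gamma p L1 (gamma p L2 0).
  apply: (alpha_inj charF0 nilN Pi_p); try by apply/mem_set; rewrite !gamma_Spi.
  by rewrite !alpha_gamma conj_actM.
apply: affbij_ext => x.
have affE (L : autalg N) y z : gamma p L (y + z) = L y + gamma p L z.
  by rewrite /= linearD /= addrA.
have L12E : (L1 * L2)%g x = L1 (L2 x) by exact: comp_lfunE.
have := affE (L1 * L2)%g x 0; rewrite addr0 E0 L12E => ->.
have := affE L2 x 0; rewrite addr0 => E2.
by rewrite -affE -E2; exact: erefl.
Qed.

Lemma gamma_inj : injective (gamma p).
Proof.
move=> L1 L2 E; have {E} Ex x : gamma p L1 x = gamma p L2 x by rewrite E.
have E0 := Ex 0; rewrite /= !linear0 !sub0r in E0.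
by apply/val_inj/lfunP => x; have := Ex x; rewrite /= E0 => /addIr.
Qed.

Lemma alpha_bij : set_bij (Spi p) (@admproj F N) (alpha p).
Proof.
have [nilN dimA] := admN; split.
- by move=> s _; apply: alpha_admproj.
- exact: alpha_inj.
move=> q Pi_q; have [s Ss <-] := alpha_surj charF0 nilN Pi_p dimA Pi_q.
by exists s.
Qed.

Lemma alpha_inv_conj L q : admproj q ->
  alpha_inv p (conj_act L q) = gamma p L (alpha_inv p q).
Proof.
move=> Pi_q; have [_ ainj asurj] := alpha_bij.
have [s Ss <-] := asurj _ Pi_q.
rewrite -alpha_gamma /alpha_inv !pinvKV //; apply/mem_set => //.
by rewrite gamma_Spi.
Qed.

End GammaAction.

(** * Restriction of the hypersurfaces to lines, and polarization *)

Lemma eq_poly_horner (F : fieldType) (f g : {poly F}) :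
  [pchar F] =i pred0 -> (forall t, f.[t] = g.[t]) -> f = g.
Proof.
move=> charF0 Efg; apply/subr0_eq.
(* In characteristic 0 the integers below the size are distinct roots. *)
apply: (@roots_geq_poly_eq0 _ _ [seq i%:R | i <- iota 0 (size (f - g)%R)]).
- by apply/allP => t _; rewrite rootE hornerD hornerN Efg subrr.
- rewrite map_inj_in_uniq ?iota_uniq // => i j _ _ /eqP.
  wlog leij : i j / (i <= j)%N.
    by case/orP: (leq_total i j) => [lij|lji] /(_ _ _) W Eij;
      [exact: W | apply/esym/W; rewrite // eq_sym].
  rewrite eq_sym -subr_eq0 -natrB // (proj1 (pcharf0P F)) // subn_eq0 => leji.
  by apply/eqP; rewrite eqn_leq leij leji.
by rewrite size_map size_iota.
Qed.

(** The polarization identities are proved in a unital ring and carried to [N] along [uext_inj]. *)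
Lemma mulr_polar2 (R : comNzRingType) (x y : R) :
  (x * y) *+ 2 = (x + y) ^+ 2 - x ^+ 2 - y ^+ 2.
Proof. by ring. Qed.

Lemma mulr_polar3 (R : comNzRingType) (x y z : R) :
  (x * (y * z)) *+ 6 =
    (x + y + z) ^+ 3 - (x + y) ^+ 3 - (y + z) ^+ 3 - (x + z) ^+ 3
    + x ^+ 3 + y ^+ 3 + z ^+ 3.
Proof. by ring. Qed.

Section Lines.
Variables (F : fieldType) (N : nuComAlgType F).
Variables (charF0 : [pchar F] =i pred0) (nilN : nilpotent_algebra N).
Implicit Types (x y z a : N) (t : F) (u w : 'Hom(N, F^o)).

Lemma npowZ t x k : npow (t *: x) k.+1 = t ^+ k.+1 *: npow x k.+1.
Proof.
elim: k => // k IH.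
rewrite -[LHS]/(nmul (t *: x) (npow (t *: x) k.+1)) IH.
by rewrite nmulZl nmulZr scalerA -exprS.
Qed.

(** Index 0 is set apart because [npow y 0] is [y], whereas [exp1] has no constant term. *)
Definition exp_line u y : {poly F} :=
  \poly_(k < (\dim {: N}).+1)
    (if k is 0 then 0 else (k`!%:R)^-1 * u (npow y k)).

Lemma coef_exp_line u y k :
  (exp_line u y)`_k.+1 = ((k.+1)`!%:R)^-1 * u (npow y k.+1).
Proof.
rewrite coef_poly; case: ltnP => // ltk.
by rewrite npow_eq0 // linear0 mulr0.
Qed.

Lemma horner_exp_line u y t : (exp_line u y).[t] = u (exp1 (t *: y)).
Proof.
rewrite horner_poly big_ord_recl mul0r add0r /exp1 big_add1 big_mkord.
rewrite linear_sum; apply: eq_bigr => i _.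
rewrite npowZ !linearZ /= mulrAC -mulrA.
by congr (_ * _); rewrite mulrC.
Qed.

Lemma line_poly_exists u x y :
  exists f : {poly F}, forall t, f.[t] = u (exp1 (x + t *: y)).
Proof.
exists ((u (exp1 x))%:P + exp_line (u \o Mul (exp x))%VF y) => t.
by rewrite hornerD hornerC horner_exp_line comp_lfunE exp1D // linearD.
Qed.

Lemma line_mul_poly_exists u x y z :
  exists f : {poly F}, forall t, f.[t] = u (Mul (exp (x + t *: y)) z).
Proof.
exists ((u (Mul (exp x) z))%:P + exp_line (u \o Mul (exp x) \o lmul z)%VF y).
move=> t; 
rewrite hornerD hornerC horner_exp_line !comp_lfunE [lmul _ _]lfunE /=.
by rewrite MulD // [in RHS](MulE (t *: y)) !linearD /= nmulC.
Qed.

(* Since exp1 (x + s a) = exp1 x + s a, the hypersurface u (exp1 x) = 0 is a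
   graph in the direction a. Hence r(t, s) = w (exp1 (A (x + t y + s a)))
   vanishes for s = - f(t), and the factor theorem over {poly F} gives that
   s + f(t) divides r(t, s); take s = 0. *)
Lemma dvdp_line u w a (A : 'End(N)) x y (f g : {poly F}) :
  a \in annihilator N -> u a = 1 ->
  (forall z, u (exp1 z) = 0 -> w (exp1 (A z)) = 0) ->
  (forall t, f.[t] = u (exp1 (x + t *: y))) ->
  (forall t, g.[t] = w (exp1 (A (x + t *: y)))) -> f %| g.
Proof.
move=> anna ua uwA Ef Eg.
(* [c j] is the coefficient of [s^(j+1)] in [exp1 (s *: A a)]; higher powers may occur, as [A a] is
   not assumed to lie in the annihilator. *)
pose c (j : nat) : N := ((j.+1)`!%:R)^-1 *: npow (A a) j.+1.
have EA t : A (x + t *: y) = A x + t *: A y by rewrite linearD linearZ.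
have /choice[h Eh] j : exists f : {poly F}, forall t,
  f.[t] = w (Mul (exp (A x + t *: A y)) (c j)) by exact: line_mul_poly_exists.
pose r : {poly {poly F}} := g%:P + \sum_(j < \dim {: N}) h j *: 'X^(j.+1).
have Er s t : r.[s].[t] = w (exp1 (A (x + t *: y + s.[t] *: a))).
  rewrite hornerD hornerC horner_sum hornerD horner_sum Eg.
  rewrite (linearD A (x + _)) exp1D // (linearD w) /=; congr (_ + _).
  rewrite linearZ /= /exp1 big_add1 big_mkord !linear_sum.
  apply: eq_bigr => j _.
  rewrite hornerZ hornerXn hornerM horner_exp Eh npowZ scalerA.
  rewrite [_^-1 * _]mulrC -scalerA -/(c j) !linearZ /= mulrC.
  by rewrite EA.
have r0 : root r (- f).
  rewrite rootE; apply/eqP/(eq_poly_horner charF0) => t; rewrite horner0 Er.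
  have annfa : (- f).[t] *: a \in annihilator N by rewrite memvZ.
  apply: uwA; rewrite addrC exp1D // MulE (exp1_ann nilN annfa).
  rewrite (annihilatorP _ annfa) addr0 linearD /= -Ef linearZ /=.
  by rewrite ua hornerN [_ *: 1]mulr1 addNr.
have [h' Eh'] := factor_theorem _ _ r0; apply/dvdpP; exists h'.[0].
have -> : g = r.[0].
  by apply: (eq_poly_horner charF0) => t; rewrite Er Eg horner0 scale0r addr0.
by rewrite Eh' hornerM hornerXsubC sub0r opprK.
Qed.

(** On each line through [a] the two restrictions divide each other, hence are proportional. All
    these lines share the point [a], where [u (exp1 a) = 1], so the constant is always
    [w (exp1 (A a))]. *)
Lemma form_proportional u w a (A : 'End(N)) :
  a \in annihilator N -> u a = 1 -> w a = 1 -> lker A == 0%VS ->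
  (forall z, u (exp1 z) = 0 <-> w (exp1 (A z)) = 0) ->
  exists2 c : F, c != 0 & forall x, w (exp1 (A x)) = c * u (exp1 x).
Proof.
move=> anna ua wa A0 uwA; have AK := lker0_lfunK A0; have KA := lker0_lfunVK A0.
have line x : exists2 c12 : F * F, (c12.1 != 0) && (c12.2 != 0) &
    forall t, c12.1 * u (exp1 (a + t *: x)) = c12.2 * w (exp1 (A (a + t *: x))).
  have [f Ef] := line_poly_exists u a x.
  have [g Eg] := line_poly_exists w (A a) (A x).
  have EA t : A (a + t *: x) = A a + t *: A x by rewrite linearD linearZ.
  have : f %= g.
    apply/andP; split.
      apply: (@dvdp_line u w a A a x) => // [z /uwA //|t].
      by rewrite Eg EA.
    (* The converse uses [A^-1] on the image line, with the same direction [a] since [w a = 1]. *)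
    apply: (@dvdp_line w u a (A^-1)%VF (A a) (A x)) => // [z wz|t].
      by apply/uwA; rewrite KA.
    by rewrite Ef -EA AK.
  case/eqpP => c12 c0 Efg; exists c12 => // t.
  by rewrite EA -Ef -Eg -!hornerZ Efg.
exists (w (exp1 (A a))) => [|x].
  have [c12 /andP[c1 c2] /(_ 0)] := line 0.
  rewrite scaler0 addr0 exp1_ann // ua mulr1 => E1.
  by apply: contraNneq c1 => wA0; rewrite E1 wA0 mulr0.
have [c12 /andP[c1 c2] E] := line (x - a); have := E 1; have := E 0.
rewrite scale0r scale1r addr0 addrC subrK exp1_ann // ua mulr1 => -> E1.
by apply: (mulfI c2); rewrite -E1 mulrA.
Qed.

Lemma npow_proportional u w (A : 'End(N)) (c : F) :
  (forall x, w (exp1 (A x)) = c * u (exp1 x)) ->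
  forall k x, w (npow (A x) k.+1) = c * u (npow x k.+1).
Proof.
move=> E k x.
have Epoly : exp_line w (A x) = c *: exp_line u x.
  apply: (eq_poly_horner charF0) => t.
  by rewrite hornerZ !horner_exp_line -E linearZ.
have := congr1 (fun f : {poly F} => f`_k.+1) Epoly.
rewrite coefZ !coef_exp_line mulrCA => /mulfI; apply.
by rewrite invr_neq0 // fact_neq0.
Qed.

Lemma nmul_polar2 x y : nmul x y *+ 2 = npow (x + y) 2 - npow x 2 - npow y 2.
Proof.
apply: uext_inj_inj.
by rewrite raddfMn !raddfB /= -!uext_injX -uext_injMn raddfD /= mulr_polar2.
Qed.

Lemma nmul_polar3 x y z : nmul x (nmul y z) *+ 6 =
  npow (x + y + z) 3 - npow (x + y) 3 - npow (y + z) 3 - npow (x + z) 3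
  + npow x 3 + npow y 3 + npow z 3.
Proof.
apply: uext_inj_inj.
rewrite raddfMn !(raddfB, raddfD) /= -!uext_injX -!uext_injMn !raddfD /=.
exact: mulr_polar3.
Qed.

Lemma mulrSnI k : injective (fun t : F => t *+ k.+1).
Proof.
move=> s t /=; rewrite -mulr_natr -[in RHS]mulr_natr; apply: mulIf.
by rewrite (proj1 (pcharf0P F)).
Qed.

Lemma form_mul2 u w (A : 'End(N)) (c : F) :
  (forall k x, w (npow (A x) k.+1) = c * u (npow x k.+1)) ->
  forall x y, w (nmul (A x) (A y)) = c * u (nmul x y).
Proof.
move=> E x y; apply: (@mulrSnI 1).
transitivity (w (nmul (A x) (A y) *+ 2)); first by rewrite raddfMn.
transitivity (c * u (nmul x y *+ 2)); last by rewrite raddfMn mulrnAr.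
by rewrite !nmul_polar2 !raddfB /= -linearD /= !E !mulrBr.
Qed.

Lemma form_mul3 u w (A : 'End(N)) (c : F) :
  (forall k x, w (npow (A x) k.+1) = c * u (npow x k.+1)) ->
  forall x y z, w (nmul (A x) (nmul (A y) (A z))) = c * u (nmul x (nmul y z)).
Proof.
move=> E x y z; apply: (@mulrSnI 5).
transitivity (w (nmul (A x) (nmul (A y) (A z)) *+ 6)); first by rewrite raddfMn.
transitivity (c * u (nmul x (nmul y z) *+ 6)); last by rewrite raddfMn mulrnAr.
by rewrite !nmul_polar3 !(raddfB, raddfD) /= -!linearD /= !E !(mulrBr, mulrDr).
Qed.

End Lines.

(** * Linear equivalences of hypersurfaces and surjectivity of [gamma p] *)

Section LinearEquivalence.
Variables (F : fieldType) (N : nuComAlgType F).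
Variables (charF0 : [pchar F] =i pred0) (admN : admissible N).

Lemma Spi_linear_autalg (p q A : 'End(N)) : admproj p -> admproj q ->
  lker A == 0%VS -> (forall z, Spi q z <-> Spi p (A z)) ->
  is_autalg A /\ forall x, p (A x) = A (q x).
Proof.
move=> Pi_p Pi_q A0 SqA; have [nilN dimA] := admN.
have [a a0 annE] := dimv1_line dimA.
have anna : a \in annihilator N by rewrite annE memv_line.
have [w wa Ew] := admproj_form Pi_p a0 annE.
have [u ua Eu] := admproj_form Pi_q a0 annE.
have form0 (v : F) : v *: a = 0 <-> v = 0.
  split=> [/eqP|->]; last exact: scale0r.
  by rewrite scaler_eq0 (negPf a0) orbF => /eqP.
have [|c c0 /(npow_proportional charF0 nilN) E] :=
  form_proportional charF0 nilN anna ua wa A0.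
  by move=> z; have := SqA z; rewrite /Spi /= Ew Eu !form0.
have E1 x : w (A x) = c * u x := E 0%N x.
have AM : {morph A : x y / nmul x y}.
  move=> x y; apply/subr0_eq/(admproj_nondeg nilN Pi_p).
    by rewrite Ew linearB /= E1 (form_mul2 charF0 E) subrr scale0r.
  (* Writing the test vector as an image under [A] turns both terms into [c * u] of the same triple
     product. *)
  move=> z; rewrite -[z](lker0_lfunVK A0) nmulDl nmulNl -nmulA Ew linearB /=.
  by rewrite (form_mul2 charF0 E) (form_mul3 charF0 E) nmulA subrr scale0r.
have Aaut : is_autalg A.
  by split=> //; exists (A^-1)%VF; [exact: lker0_lfunK | exact: lker0_lfunVK].
split=> // x; have annAq : A (q x) \in annihilator N.
  rewrite -(autalg_annihilator (AutAlg (asboolT Aaut))) memv_img //.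
  exact: admproj_ann.
(* As [p] fixes [A (q x)], it remains to see [p (A (x - q x)) = 0], which follows from [E1] and
   [q (x - q x) = 0]. *)
rewrite -[RHS](admproj_id Pi_p annAq); apply/subr0_eq.
rewrite -!linearB /= Ew E1; apply/form0/eqP; rewrite mulf_eq0 (negPf c0) /=.
have /form0 -> // : u (x - q x) *: a = 0.
by rewrite -Eu linearB /= (admproj_id Pi_q (admproj_ann Pi_q x)) subrr.
Qed.

Lemma gamma_affstab (p : 'End(N)) (L : autalg N) :
  admproj p -> affstab (Spi p) (gamma p L).
Proof.
move=> Pi_p; apply/seteqP; split=> [_ [s Ss <-]|s Ss].
  by apply/(gamma_Spi charF0 admN Pi_p).
have [_ [h _ hK]] := affbijP (gamma p L).
exists (h s); rewrite ?hK //.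
by apply/(gamma_Spi charF0 admN Pi_p L); rewrite hK.
Qed.

Lemma gamma_surj (p : 'End(N)) (g : affbij N) :
  admproj p -> affstab (Spi p) g -> exists L, gamma p L = g.
Proof.
move=> Pi_p gS; have [nilN dimA] := admN.
have [[A [b gE]] g_bij] := affbijP g; have g_inj := bij_inj g_bij.
have gSE x : Spi p x <-> Spi p (g x).
  split=> [Sx|]; first by rewrite -gS; exists x.
  by rewrite -{1}gS => -[y Sy /g_inj <-].
(* The point [c] that [g] sends to 0 is the candidate for [ctrans p L]; centred there, [g] becomes
   linear. *)
have [c Sc gc] : [set g x | x in Spi p] 0.
  by rewrite gS /Spi /= exp1_0 // linear0.
have gA y : g (c + y) = A y.
  by move: gc; rewrite !gE linearD /= addrAC => ->; rewrite add0r.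
have A0 : lker A == 0%VS.
  by apply/lker0P => x y; rewrite -!gA => /g_inj/addrI.
have [|Aaut Ac] := Spi_linear_autalg Pi_p (alpha_admproj c Pi_p) A0.
  move=> z; apply: iff_trans (iff_sym (Spi_translate charF0 nilN z Sc)) _.
  by rewrite -gA; exact: gSE.
pose L := AutAlg (asboolT Aaut).
exists L; have [d [_ uniqd]] := ctrans_exists_unique charF0 admN Pi_p L.
have Lc : is_ctrans p L c by split=> //; apply/conj_actP.
have cE : ctrans p L = c.
  by rewrite -(uniqd _ Lc) -(uniqd _ (ctransP charF0 admN Pi_p L)).
apply: affbij_ext => x.
transitivity (A x - A c); first by rewrite /= cE.
by rewrite -linearB /= -gA addrC subrK.
Qed.

End LinearEquivalence.

Theorem mainTheorem3 (F : fieldType) (charF0 : [pchar F] =i pred0)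
    (N : nuComAlgType F) (admN : admissible N)
    (p : 'End(N)) (Pi_p : admproj p) :
  [/\ forall L : autalg N, exists! c : N, is_ctrans p L c,
      set_bij (Spi p) (@admproj F N) (alpha p),
      {morph gamma p : L1 L2 / (L1 * L2)%g},
      set_bij [set: autalg N] (affstab (Spi p)) (gamma p) &
      forall (L : autalg N) (rho : 'End(N)), admproj rho ->
        alpha_inv p (conj_act L rho) = gamma p L (alpha_inv p rho)].
Proof.
split.
- exact: ctrans_exists_unique.
- exact: alpha_bij.
- exact: gammaM.
- split=> [L _|L1 L2 _ _|g Sg]; first exact: gamma_affstab.
    exact: gamma_inj.
  by have [L EL] := gamma_surj charF0 admN Pi_p Sg; exists L.
exact: alpha_inv_conj.
Qed.
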